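(* Let $n\ge 2$ be even, let $\mathscr{C}_H\subseteq\mathbb{F}_2^{2^n-1}$ be the $[2^n-1,\,2^n-1-n,\,3]$ Hamming code, and let $\mathcal{C}_e$, $\mathcal{C}_o$ be its subsets of even-weight and odd-weight codewords. Fix orderings $\mathbf{v}_1,\ldots,\mathbf{v}_{|\mathcal{C}_e|}$ of $\mathcal{C}_e$ and $\mathbf{w}_1,\ldots,\mathbf{w}_{|\mathcal{C}_o|}$ of $\mathcal{C}_o$, fix $\mathbf{w}'\in\mathcal{C}_o$, let $\phi:\mathcal{C}_e\to\mathcal{C}_o$ be $\phi(\mathbf{v})=\mathbf{v}\oplus\mathbf{w}'$, and let $P$ be the permutation matrix with $P_{ik}=1$ if $\mathbf{w}_i=\phi(\mathbf{v}_k)$ and $0$ otherwise. Let $\mathbf{u}\in\mathbb{F}_2^{2^n-1}$ be the punctured truth table of any bent function $f_{\mathbf{u}}:\mathbb{F}_2^n\to\{0,1\}$ with $f_{\mathbf{u}}(\mathbf{0})=0$. Then the cut vector $$\mathbf{z}=P\,\bigl[(-1)^{\mathbf{u}\cdot\mathbf{v}_1},(-1)^{\mathbf{u}\cdot\mathbf{v}_2},\ldots,(-1)^{\mathbf{u}\cdot\mathbf{v}_{|\mathcal{C}_e|}}\bigr]^\top$$ defines an optimal parity assignment for $\mathcal{C}_o$: for $\{\mathbf{p}',\overline{\mathbf{p}'}\}\in\{P_e,P_o\}$, the assignment giving $\mathbf{w}_i$ the parity $\mathbf{p}'$ if $z_i=+1$ and $\overline{\mathbf{p}'}$ if $z_i=-1$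 is optimal for $\mathcal{C}_o$.
   Context: The $[2^n-1,\,2^n-1-n,\,3]$ Hamming code is the kernel over $\mathbb{F}_2$ of the $n\times(2^n-1)$ matrix $H$ whose columns are all the nonzero vectors of $\mathbb{F}_2^n$, listed in lexicographic order; every non-codeword is at Hamming distance $1$ from exactly one codeword. The punctured truth table of $f:\mathbb{F}_2^n\to\{0,1\}$ is the vector in $\mathbb{F}_2^{2^n-1}$ listing the values $f(\mathbf{x})$ for nonzero $\mathbf{x}$ in lexicographic order. A function $f:\mathbb{F}_2^n\to\{0,1\}$ is bent if $\bigl|\sum_{\mathbf{x}\in\mathbb{F}_2^n}(-1)^{f(\mathbf{x})+\mathbf{a}\cdot\mathbf{x}}\bigr|=2^{n/2}$ for all $\mathbf{a}\in\mathbb{F}_2^n$. $\oplus$ is addition and $\mathbf{u}\cdot\mathbf{v}$ the inner product over $\mathbb{F}_2$; an overline on a bit vector denotes bitwise complement. Let $P_e=\{00,11\}$ and $P_o=\{01,10\}$, and let $\{R,R'\}=\{P_e,P_o\}$. Given parity assignments $a:\mathcal{C}_e\to R$ and $b:\mathcal{C}_o\to R'$, let $\mathbf{p}_{a,b}:\mathbb{F}_2^{2^n-1}\to\mathbb{F}_2^2$ equal $a$ on $\mathcal{C}_e$, $b$ on $\mathcal{C}_o$, and on a non-codeword equal the bitwise complement of the parity of its unique nearest codeword. Let $\mathrm{Enc}_{a,b}(\mathbf{x})=(\mathbf{x},\mathbf{p}_{a,b}(\mathbf{x}))$ and let $N_2(a,b)$ be the number of unordered pairs of distinct $\mathbf{x},\mathbf{y}\in\mathbb{F}_2^{2^n-1}$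 with $d_H(\mathrm{Enc}_{a,b}(\mathbf{x}),\mathrm{Enc}_{a,b}(\mathbf{y}))=2$, where $d_H$ is Hamming distance. A parity assignment $b:\mathcal{C}_o\to R'$ is optimal for $\mathcal{C}_o$ if $N_2(a,b)\le N_2(a,b')$ for all $b':\mathcal{C}_o\to R'$ and all $a:\mathcal{C}_e\to R$. *)

(* Defs.v *)
From mathcomp Require Export all_boot all_order all_algebra.

Set Implicit Arguments.
Unset Strict Implicit.
Unset Printing Implicit Defensive.

Import Order.TTheory GRing.Theory Num.Theory.
Local Open Scope ring_scope.

Notation word n := 'rV['F_2]_(2 ^ n - 1).

Definition dotv m (x y : 'rV['F_2]_m) : 'F_2 := \sum_i x 0 i * y 0 i.

Definition wt m (x : 'rV['F_2]_m) : nat := #|[set i | x 0 i != 0]|.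

Definition dH m (x y : 'rV['F_2]_m) : nat := #|[set i | x 0 i != y 0 i]|.

Definition bcompl m (x : 'rV['F_2]_m) : 'rV['F_2]_m := \row_i (x 0 i + 1).

(* (-1)^c; c is read through its representative in {0, 1}. *)
Definition sgn2 (c : 'F_2) : int := (-1) ^+ (c : nat).

Definition bits m (x : 'rV['F_2]_m) : seqlexi nat :=
  [seq (x 0 i : nat) | i <- enum 'I_m].

Definition lexle m : rel 'rV['F_2]_m := fun x y => (bits x <= bits y)%O.

(* A list of length 2 ^ m - 1, so the default value 0 of [nth] in [nzvec] below
   is never returned. *)
Definition nzvecs m : seq 'rV['F_2]_m :=
  sort (@lexle m) (enum [set x : 'rV['F_2]_m | x != 0]).

Definition nzvec n (j : 'I_(2 ^ n - 1)) : 'rV['F_2]_n := nth 0 (nzvecs n) j.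

Definition hammingH n : 'M['F_2]_(n, 2 ^ n - 1) :=
  \matrix_(i, j) nzvec j 0 i.

Definition hamming n : {set word n} := [set x | hammingH n *m x^T == 0].

Definition Ce n : {set word n} := [set x in hamming n | ~~ odd (wt x)].
Definition Co n : {set word n} := [set x in hamming n | odd (wt x)].

Definition punctured n (f : 'rV['F_2]_n -> 'F_2) : word n :=
  \row_j f (nzvec j).

(* n./2 is rounded down, so this is the usual notion only for even n. *)
Definition bent n (f : 'rV['F_2]_n -> 'F_2) : Prop :=
  forall a : 'rV['F_2]_n,
    `| \sum_(x : 'rV['F_2]_n) sgn2 (f x + dotv a x) | = 2 ^+ n./2 :> int.

Definition bits2 (s t : 'F_2) : 'rV['F_2]_2 := \row_i (if i == 0 then s else t).

Definition Pe : {set 'rV['F_2]_2} := [set bits2 0 0; bits2 1 1].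
Definition Po : {set 'rV['F_2]_2} := [set bits2 0 1; bits2 1 0].

(* A parity assignment C -> R is a total function constrained only on C; the
   definitions below never depend on its values outside C. *)
Definition assignment n (C : {set word n}) (R : {set 'rV['F_2]_2})
    (b : word n -> 'rV['F_2]_2) : Prop :=
  {in C, forall c, b c \in R}.

(* The nearest codeword is unique, so the choice made by [arg min] is
   immaterial; 0 only witnesses that the code is nonempty. *)
Definition nearest n (x : word n) : word n :=
  [arg min_(c < 0 in hamming n) dH x c].

Definition codeparity n (a b : word n -> 'rV['F_2]_2) (c : word n) :
    'rV['F_2]_2 :=
  if c \in Ce n then a c else b c.

Definition parity n (a b : word n -> 'rV['F_2]_2) (x : word n) : 'rV['F_2]_2 :=
  if x \in hamming n then codeparity a b x
  else bcompl (codeparity a b (nearest x)).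

Definition Enc n (a b : word n -> 'rV['F_2]_2) (x : word n) :
    'rV['F_2]_((2 ^ n - 1) + 2) :=
  row_mx x (parity a b x).

Definition N2 n (a b : word n -> 'rV['F_2]_2) : nat :=
  #|[set A : {set word n} | [exists x, exists y,
      [&& x != y, A == [set x; y] & dH (Enc a b x) (Enc a b y) == 2]]]|.

Definition optimal n (R R' : {set 'rV['F_2]_2}) (b : word n -> 'rV['F_2]_2) :
    Prop :=
  assignment (Co n) R' b /\
  forall a b' : word n -> 'rV['F_2]_2,
    assignment (Ce n) R a -> assignment (Co n) R' b' ->
    (N2 a b <= N2 a b')%N.

Definition permP n (v : #|Ce n|.-tuple (word n)) (w : #|Co n|.-tuple (word n))
    (w' : word n) : 'M[int]_(#|Co n|, #|Ce n|) :=
  \matrix_(i, k) (tnth w i == tnth v k + w')%:R.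

Definition cutvec n (v : #|Ce n|.-tuple (word n))
    (w : #|Co n|.-tuple (word n)) (w' u : word n) : 'cV[int]_#|Co n| :=
  permP v w w' *m \col_k sgn2 (dotv u (tnth v k)).

(* Main.v *)
(* Two words at distance 1 with parities at distance 1 contribute to [N2]
   independently of the assignments, and words at distance 2 with equal parity
   have nearest codewords of the same weight parity, which coincide or are at
   distance 4.  Hence, up to a constant, [N2] counts the pairs of equally
   coloured codewords at distance 4, separately in [Ce] and [Co], and minimising
   over [b] is a max-cut problem on the graph joining the codewords of [Co] at
   distance 4.
   That graph is a translate of a Cayley graph, so its spectrum consists of the
   character sums [eigen v], the cut is bounded by the least of them, and a
   character cut attains its own eigenvalue.  If F is the function (-1)^v,
   extended by 0 at the origin, with Fourier transform X, then 2^n eigen v is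
   the sum of the X(a)^4, while the sum of the X(a)^2 is fixed.  As X(a) is an
   odd integer and q = 2^(n/2) is even,
     (X^2 - (q - 1)^2) (X^2 - (q + 1)^2) >= 0,
   which bounds the fourth moment below by an affine function of the second;
   for a bent function X takes only the values q - 1 and - q - 1, and equality
   holds. *)
Require Import Defs.
From mathcomp Require Import all_boot all_order all_algebra.
From mathcomp Require Import zify ring.

Set Implicit Arguments.
Unset Strict Implicit.
Unset Printing Implicit Defensive.

Import Order.TTheory GRing.Theory Num.Theory.
Local Open Scope ring_scope.

(** * Signs and inner products over the two-element field *)

Lemma F2P (c : 'F_2) : c = 0 \/ c = 1.
Proof. by case: c => [[|[|//]] hc]; [left|right]; apply: val_inj. Qed.

Lemma F2_neq0 (c : 'F_2) : c != 0 -> c = 1.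
Proof. by case: (F2P c) => -> //; rewrite eqxx. Qed.

Lemma addF2 (c : 'F_2) : c + c = 0.
Proof. by case: (F2P c) => ->; apply: val_inj. Qed.

Lemma addv_self m (x : 'rV['F_2]_m) : x + x = 0.
Proof. by apply/rowP => i; rewrite !mxE addF2. Qed.

Lemma addv_selfK m (y x : 'rV['F_2]_m) : x + y + y = x.
Proof. by rewrite -addrA addv_self addr0. Qed.

Lemma addv_eq0 m (x y : 'rV['F_2]_m) : (x + y == 0) = (x == y).
Proof.
apply/eqP/eqP => [h|->]; last exact: addv_self.
by rewrite -[x](addv_selfK y) h add0r.
Qed.

Lemma sgn2D (c d : 'F_2) : sgn2 (c + d) = sgn2 c * sgn2 d.
Proof. by case: (F2P c) => ->; case: (F2P d) => ->. Qed.

Lemma sgn2_sqr (c : 'F_2) : sgn2 c * sgn2 c = 1.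
Proof. by rewrite -sgn2D addF2. Qed.

Lemma sgn2P (c : 'F_2) : sgn2 c = 1 \/ sgn2 c = -1.
Proof. by case: (F2P c) => ->; [left|right]. Qed.

Lemma dotvDl m (x y z : 'rV['F_2]_m) : dotv (x + y) z = dotv x z + dotv y z.
Proof.
by rewrite /dotv -big_split; apply: eq_bigr => i _; rewrite !mxE mulrDl.
Qed.

Lemma dotvC m (x y : 'rV['F_2]_m) : dotv x y = dotv y x.
Proof. by apply: eq_bigr => i _; rewrite mulrC. Qed.

Lemma dotvDr m (x y z : 'rV['F_2]_m) : dotv z (x + y) = dotv z x + dotv z y.
Proof. by rewrite dotvC dotvDl !(dotvC z). Qed.

Lemma dotv_delta m (x : 'rV['F_2]_m) i : dotv x (delta_mx 0 i) = x 0 i.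
Proof.
rewrite /dotv (bigD1 i) //= mxE !eqxx mulr1 big1 ?addr0 // => j ji.
by rewrite mxE (negbTE ji) andbF mulr0.
Qed.

Lemma dotv0r m (x : 'rV['F_2]_m) : dotv x 0 = 0.
Proof. by rewrite /dotv big1 // => i _; rewrite mxE mulr0. Qed.

(** * Character sums and the Fourier transform *)

Lemma sum_translate m (V : nmodType) (z : 'rV['F_2]_m) (F : 'rV['F_2]_m -> V) :
  \sum_x F x = \sum_x F (x + z).
Proof.
rewrite (reindex (fun x => x + z)) //.
by exists (fun x => x + z) => x _; rewrite addv_selfK.
Qed.

(** Orthogonality of characters: if [z] is nonzero at [k], adding the [k]-th unit vector to [a]
    flips every term, so the sum is its own opposite. *)
Lemma sum_sgn2_dotv m (z : 'rV['F_2]_m) :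
  \sum_a sgn2 (dotv a z) = (2 ^ m)%:R *+ (z == 0).
Proof.
case: eqP => [->|/eqP z0] /=.
  under eq_bigr do rewrite dotv0r.
  by rewrite sumr_const /= card_mx card_Fp // mul1n.
have [k zk] : exists k, z 0 k != 0.
  apply/existsP; apply: contraNT z0 => /existsPn h.
  by apply/eqP/rowP => k; rewrite mxE; apply/eqP; move: (h k); rewrite negbK.
have := sum_translate (delta_mx 0 k) (fun a => sgn2 (dotv a z)).
under [X in _ = X]eq_bigr => a _.
  rewrite dotvDl (dotvC (delta_mx _ _)) dotv_delta (F2_neq0 zk) sgn2D.
  have -> : sgn2 1 = -1 by []. rewrite mulrN1.
  over.
rewrite sumrN mulr0n; move: (\sum_a _) => S h; lia.
Qed.

Definition fourier m (g : 'rV['F_2]_m -> int) (u : 'rV['F_2]_m) : int :=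
  \sum_x g x * sgn2 (dotv u x).

(** After the square is expanded, summing over [u] kills every pair except [y = x + z]. *)
Lemma sum_fourier_sqr m (g : 'rV['F_2]_m -> int) (z : 'rV['F_2]_m) :
  \sum_u fourier g u ^+ 2 * sgn2 (dotv u z) =
  (2 ^ m)%:R * \sum_x g x * g (x + z).
Proof.
transitivity (\sum_u \sum_x \sum_y g x * g y * sgn2 (dotv u (x + y + z))).
  apply: eq_bigr => u _; rewrite expr2 /fourier mulr_suml mulr_suml.
  apply: eq_bigr => x _; rewrite mulr_sumr mulr_suml.
  by apply: eq_bigr => y _; rewrite !dotvDr !sgn2D; ring.
rewrite exchange_big mulr_sumr; apply: eq_bigr => x _ /=.
rewrite exchange_big (bigD1 (x + z)) //= [X in _ + X]big1 ?addr0 => [|y hy].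
  rewrite -mulr_sumr sum_sgn2_dotv addrA addv_self add0r addv_self eqxx mulr1n.
  by rewrite mulrC.
rewrite -mulr_sumr sum_sgn2_dotv -addrA [y + z]addrC addrA addv_eq0.
by rewrite eq_sym (negbTE hy) mulr0n mulr0.
Qed.

(** * The columns of the parity-check matrix *)

Lemma size_nzvecs n : size (nzvecs n) = (2 ^ n - 1)%N.
Proof.
rewrite size_sort -cardE.
have -> : [set x : 'rV['F_2]_n | x != 0] = [set~ 0].
  by apply/setP => x; rewrite !inE.
by rewrite cardsC1 card_mx card_Fp // mul1n subn1.
Qed.

Lemma uniq_nzvecs n : uniq (nzvecs n).
Proof. by rewrite sort_uniq enum_uniq. Qed.

Lemma mem_nzvecs n x : (x \in nzvecs n) = (x != 0).
Proof. by rewrite mem_sort mem_enum inE. Qed.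

Lemma nzvec_neq0 n (j : 'I_(2 ^ n - 1)) : nzvec j != 0.
Proof. by rewrite -mem_nzvecs mem_nth // size_nzvecs. Qed.

Lemma nzvec_inj n : injective (@nzvec n).
Proof.
move=> i j /eqP h; apply: val_inj; apply/eqP.
by move: h; rewrite nth_uniq ?size_nzvecs ?uniq_nzvecs.
Qed.

Lemma nzvec_surj n (x : 'rV['F_2]_n) : x != 0 -> exists j, nzvec j = x.
Proof.
rewrite -mem_nzvecs => hx.
have hi : (index x (nzvecs n) < 2 ^ n - 1)%N by rewrite -size_nzvecs index_mem.
by exists (Ordinal hi); apply: nth_index.
Qed.

Lemma sum_nzvec n (V : zmodType) (F : 'rV['F_2]_n -> V) :
  \sum_j F (nzvec j) = \sum_x F x - F 0.
Proof.
rewrite [in RHS](bigD1 0) //= addrAC subrr add0r.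
have -> : \sum_j F (nzvec j) = \sum_(x <- nzvecs n) F x.
  by rewrite (big_nth 0) size_nzvecs big_mkord.
rewrite -big_filter; apply: perm_big; apply: uniq_perm.
- exact: uniq_nzvecs.
- by rewrite filter_uniq // index_enum_uniq.
by move=> x; rewrite mem_nzvecs mem_filter mem_index_enum andbT.
Qed.

(** * Syndromes *)

Definition syn n (x : word n) : 'rV['F_2]_n := \sum_j x 0 j *: nzvec j.

Lemma synD n (x y : word n) : syn (x + y) = syn x + syn y.
Proof.
by rewrite /syn -big_split; apply: eq_bigr => j _; rewrite mxE scalerDl.
Qed.

Lemma syn0 n : syn (0 : word n) = 0.
Proof. by rewrite /syn big1 // => j _; rewrite mxE scale0r. Qed.

Lemma syn_delta n j : syn (delta_mx 0 j : word n) = nzvec j.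
Proof.
rewrite /syn (bigD1 j) //= mxE !eqxx scale1r big1 ?addr0 // => i ij.
by rewrite mxE (negbTE ij) andbF scale0r.
Qed.

Lemma mem_hamming n (x : word n) : (x \in hamming n) = (syn x == 0).
Proof.
rewrite inE; have -> : hammingH n *m x^T = (syn x)^T.
  apply/matrixP => i k; rewrite !mxE /syn summxE ord1.
  by apply: eq_bigr => j _; rewrite !mxE mulrC.
by rewrite -(inj_eq trmx_inj) trmxK trmx0.
Qed.

Lemma hammingD n (c x : word n) :
  c \in hamming n -> (c + x \in hamming n) = (x \in hamming n).
Proof. by rewrite !mem_hamming synD => /eqP ->; rewrite add0r. Qed.

(** * Weight parity and Hamming distance *)

Definition par m (x : 'rV['F_2]_m) : 'F_2 := \sum_i x 0 i.

Lemma parD m (x y : 'rV['F_2]_m) : par (x + y) = par x + par y.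
Proof. by rewrite /par -big_split; apply: eq_bigr => i _; rewrite mxE. Qed.

Lemma par_delta m (j : 'I_m) : par (delta_mx 0 j) = 1.
Proof.
rewrite /par (bigD1 j) //= mxE !eqxx big1 ?addr0 // => i ij.
by rewrite mxE (negbTE ij) andbF.
Qed.

Lemma odd_wt m (x : 'rV['F_2]_m) : odd (wt x) = (par x != 0).
Proof.
have -> : par x = (wt x)%:R.
  rewrite /wt cardsE -sum1_card natr_sum /= /par [RHS]big_mkcond /=.
  apply: eq_bigr => i _; 
  by rewrite unfold_in; case: eqP => [->|/eqP /F2_neq0 ->].
elim: (wt x) => [//|k IH] /=.
by rewrite IH -natr1; case: (F2P k%:R) => ->.
Qed.

Lemma mem_Ce n (x : word n) : (x \in Ce n) = (x \in hamming n) && (par x == 0).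
Proof. by rewrite inE odd_wt negbK. Qed.

Lemma mem_Co n (x : word n) : (x \in Co n) = (x \in hamming n) && (par x != 0).
Proof. by rewrite inE odd_wt. Qed.

Lemma dH_wt m (x y : 'rV['F_2]_m) : dH x y = wt (x + y).
Proof.
by apply: eq_card => i; rewrite !inE mxE; case: (F2P (x 0 i)) => ->; 
  case: (F2P (y 0 i)) => ->.
Qed.

Lemma wt_eq0 m (x : 'rV['F_2]_m) : (wt x == 0)%N = (x == 0).
Proof.
rewrite cards_eq0; apply/eqP/eqP => [/setP h|->].
  by apply/rowP => i; have := h i; rewrite !inE mxE => /negbFE /eqP.
by apply/setP => i; rewrite !inE mxE eqxx.
Qed.

Lemma supp_delta m (j : 'I_m) :
  [set i | (delta_mx 0 j : 'rV['F_2]_m) 0 i != 0] = [set j].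
Proof. by apply/setP => i; rewrite !inE mxE eqxx /=; case: (i == j). Qed.

Lemma supp_inj m (x y : 'rV['F_2]_m) :
  [set i | x 0 i != 0] = [set i | y 0 i != 0] -> x = y.
Proof.
move=> /setP h; apply/rowP => i; have := h i; rewrite !inE.
by case: (F2P (x 0 i)) => ->; case: (F2P (y 0 i)) => ->.
Qed.

Lemma wt_delta m (j : 'I_m) : wt (delta_mx 0 j : 'rV['F_2]_m) = 1%N.
Proof. by rewrite /wt supp_delta cards1. Qed.

Lemma wt_le1 m (x : 'rV['F_2]_m) :
  (wt x <= 1)%N -> x = 0 \/ exists j, x = delta_mx 0 j.
Proof.
rewrite leq_eqVlt ltnS leqn0 wt_eq0 => /orP[/cards1P [j hj]|/eqP ->]; last by left.
by right; exists j; apply: supp_inj; rewrite hj supp_delta.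
Qed.

(** * Nearest codewords and perfectness of the code *)

Lemma nearest_code n (c : word n) : c \in hamming n -> nearest c = c.
Proof.
rewrite /nearest => hc; case: arg_minnP => [|y hy /(_ c hc)].
  by rewrite mem_hamming syn0.
rewrite !dH_wt addv_self.
have /eqP -> : wt (0 : word n) == 0%N by rewrite wt_eq0.
by rewrite leqn0 wt_eq0 addv_eq0 => /eqP.
Qed.

(** A minimiser [y] is within distance 1 of the word because [c] is. The difference has syndrome
    [nzvec s], so it is the unit vector at [s], and [y = c]. *)
Lemma nearest_add_delta n (c : word n) s :
  c \in hamming n -> nearest (c + delta_mx 0 s) = c.
Proof.
rewrite /nearest => hc; case: arg_minnP => [|y hy /(_ c hc)].
  by rewrite mem_hamming syn0.
rewrite !dH_wt [c + _ + c]addrC addrA addv_self add0r wt_delta => /wt_le1 h.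
move: hy hc; rewrite !mem_hamming => /eqP hy /eqP hc.
have : syn (c + delta_mx 0 s + y) = nzvec s.
  by rewrite !synD hy hc add0r addr0 syn_delta.
case: h => [->|[j hj]].
  by rewrite syn0 => /esym/eqP; rewrite (negbTE (nzvec_neq0 s)).
rewrite hj syn_delta => /nzvec_inj js; move: hj.
rewrite js => /(congr1 (fun t => t + delta_mx 0 s)).
rewrite addv_self addrAC addv_selfK => /eqP.
by rewrite addv_eq0 => /eqP.
Qed.

(** Each nonzero syndrome occurs exactly once as a column, so exactly one flip reaches the code:
    this is perfectness. *)
Lemma syn_col n (x : word n) :
  syn x != 0 -> exists t, forall s, (x + delta_mx 0 s \in hamming n) = (s == t).
Proof.
move=> /nzvec_surj [t ht]; exists t => s.
by rewrite mem_hamming synD syn_delta -ht addv_eq0 eq_sym (inj_eq (@nzvec_inj n)).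
Qed.

Lemma sum_noncode n (V : nmodType) (F : word n -> V) :
  \sum_(x | x \notin hamming n) F x =
  \sum_(c in hamming n) \sum_s F (c + delta_mx 0 s).
Proof.
(* Each non-codeword is counted once, at the single [s] whose flip corrects it. *)
transitivity (\sum_x \sum_(s | x + delta_mx 0 s \in hamming n)
   if x \notin hamming n then F x else 0).
  rewrite big_mkcond; apply: eq_bigr => x _.
  case: ifP => hx; last by rewrite big1.
  move: hx; rewrite mem_hamming => /syn_col [t ht].
  by rewrite (eq_bigl (pred1 t)) ?big_pred1_eq.
under eq_bigr do rewrite big_mkcond /=.
rewrite exchange_big [RHS]exchange_big /=; apply: eq_bigr => s _.
rewrite (sum_translate (delta_mx 0 s)) [RHS]big_mkcond /=.
apply: eq_bigr => c _; rewrite addv_selfK; case: ifP => // hc.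
by rewrite hammingD // mem_hamming syn_delta (nzvec_neq0).
Qed.

(** * Moments of the Walsh transform and the least eigenvalue *)

Definition delta2 m (p : 'I_m * 'I_m) : 'rV['F_2]_m :=
  delta_mx 0 p.1 + delta_mx 0 p.2.

(** The number X(a) for the word [u]: a Walsh transform with the term at the origin left out. *)
Definition pwalsh n (u : word n) (a : 'rV['F_2]_n) : int :=
  \sum_j sgn2 (u 0 j + dotv a (nzvec j)).

(* The sum runs over all ordered quadruples of coordinates whose columns of the
   parity-check matrix sum to 0; the degenerate ones only shift every eigenvalue
   by the same constant. *)
Definition eigen n (u : word n) : int :=
  \sum_(t | delta2 t.1 + delta2 t.2 \in hamming n)
     sgn2 (dotv u (delta2 t.1 + delta2 t.2)).

Lemma pwalsh_sqr n (u : word n) a :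
  pwalsh u a ^+ 2 = \sum_p sgn2 (dotv u (delta2 p) + dotv a (syn (delta2 p))).
Proof.
rewrite expr2 /pwalsh mulr_suml -(pair_big xpredT xpredT
  (fun i j => sgn2 (dotv u (delta2 (i, j)) + dotv a (syn (delta2 (i, j)))))) /=.
apply: eq_bigr => i _; rewrite mulr_sumr; apply: eq_bigr => j _.
by rewrite /delta2 synD !syn_delta !dotvDr !dotv_delta !sgn2D; ring.
Qed.

(** The fourth power expands over ordered quadruples of coordinates; summing over [a] keeps those
    with zero syndrome. *)
Lemma sum_pwalsh4 n (u : word n) :
  \sum_a pwalsh u a ^+ 4 = (2 ^ n)%:R * eigen u.
Proof.
transitivity (\sum_a \sum_(t : _ * _) sgn2 (dotv u (delta2 t.1 + delta2 t.2)) *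
   sgn2 (dotv a (syn (delta2 t.1 + delta2 t.2)))).
  apply: eq_bigr => a _.
  rewrite -[4%N]/(2 * 2)%N exprM pwalsh_sqr expr2 mulr_suml.
  rewrite -(pair_big xpredT xpredT (fun p q =>
    sgn2 (dotv u (delta2 p + delta2 q)) *
    sgn2 (dotv a (syn (delta2 p + delta2 q))))) /=.
  apply: eq_bigr => p _; rewrite mulr_sumr; apply: eq_bigr => q _.
  by rewrite synD !dotvDr !sgn2D; ring.
rewrite exchange_big mulr_sumr [RHS]big_mkcond /=; apply: eq_bigr => t _.
rewrite -mulr_sumr sum_sgn2_dotv mem_hamming.
by case: eqP => _; rewrite ?mulr0n ?mulr0 // mulr1n mulrC.
Qed.

(** Parseval: the columns are distinct, so only the diagonal terms of the square survive. *)
Lemma sum_pwalsh2 n (u : word n) :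
  \sum_a pwalsh u a ^+ 2 = (2 ^ n)%:R * (2 ^ n - 1)%:R.
Proof.
under eq_bigr do rewrite pwalsh_sqr.
rewrite exchange_big /= -(pair_big xpredT xpredT (fun i j =>
  \sum_a sgn2 (dotv u (delta2 (i, j)) + dotv a (syn (delta2 (i, j)))))) /=.
rewrite mulr_natr -[X in _ *+ X]card_ord -sumr_const; apply: eq_bigr => i _.
rewrite (bigD1 i) //= [X in _ + X]big1 ?addr0 => [|j ji].
  under eq_bigr do rewrite /delta2 addv_self syn0 !dotv0r addr0.
  by rewrite sumr_const card_mx card_Fp // mul1n.
under eq_bigr do rewrite sgn2D.
rewrite -mulr_sumr sum_sgn2_dotv /delta2 synD !syn_delta addv_eq0.
by rewrite (inj_eq (@nzvec_inj n)) eq_sym (negbTE ji) mulr0.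
Qed.

(** A sum of [2 ^ n - 1] signs, which is an odd number of odd terms when [0 < n]. *)
Lemma pwalsh_odd n (u : word n) a :
  (0 < n)%N -> exists k : int, pwalsh u a = 2 * k + 1.
Proof.
move=> n0; have -> : pwalsh u a =
    \sum_j (1 - 2 * (u 0 j + dotv a (nzvec j) != 0)%:R).
  by apply: eq_bigr => j _; case: (F2P (u 0 j + dotv a (nzvec j))) => ->.
rewrite sumrB -mulr_sumr sumr_const card_ord.
move: (\sum_i _) => S; have -> : (2 ^ n - 1)%N = ((2 ^ n.-1 - 1) * 2).+1.
  by case: n n0 u a S => // n _ _ _ _; rewrite expnS /=; have := expn_gt0 2 n; lia.
by exists ((2 ^ n.-1 - 1)%:R - S); rewrite mulrS natrM; ring.
Qed.

(** The four linear factors regroup into two products of consecutive integers, neither of which is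
    negative. *)
Lemma odd_sqr_bound (X q : int) k l : X = 2 * k + 1 -> q = 2 * l ->
  0 <= (X ^+ 2 - (q - 1) ^+ 2) * (X ^+ 2 - (q + 1) ^+ 2).
Proof.
move=> -> ->.
have -> : ((2 * k + 1) ^+ 2 - (2 * l - 1) ^+ 2) *
    ((2 * k + 1) ^+ 2 - (2 * l + 1) ^+ 2)
  = 16 * (((k + l) * (k + l + 1)) * ((k - l) * (k - l + 1))) by ring.
have h (z : int) : 0 <= z * (z + 1) by nia.
by rewrite mulr_ge0 // mulr_ge0.
Qed.

Lemma eigen_bent_min n (f : 'rV['F_2]_n -> 'F_2) (u : word n) :
  (2 <= n)%N -> ~~ odd n -> bent f -> f 0 = 0 -> eigen (punctured f) <= eigen u.
Proof.
move=> n2 nev fb f0; pose q : int := 2 ^+ n./2.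
have q2 : q ^+ 2 = (2 ^ n)%:R.
  by rewrite /q -exprM muln2 even_halfK // natrX.
have [l ql] : exists l : int, q = 2 * l.
  by exists (2 ^+ (n./2).-1); rewrite -exprS prednK // half_gt0.
have gap (v : word n) a : pwalsh v a ^+ 4 =
    (2 * (q ^+ 2 + 1) * pwalsh v a ^+ 2 - (q ^+ 2 - 1) ^+ 2)
    + (pwalsh v a ^+ 2 - (q - 1) ^+ 2) * (pwalsh v a ^+ 2 - (q + 1) ^+ 2) by ring.
have bentX a : (pwalsh (punctured f) a ^+ 2 - (q - 1) ^+ 2) *
               (pwalsh (punctured f) a ^+ 2 - (q + 1) ^+ 2) = 0.
  (* The origin would contribute [sgn2 0 = 1], so X is the full Walsh sum minus 1, that is [q - 1]
     or [- q - 1]. *)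
  have -> : pwalsh (punctured f) a = \sum_x sgn2 (f x + dotv a x) - 1.
    rewrite /pwalsh; under eq_bigr do rewrite mxE.
    by rewrite (sum_nzvec (fun x => sgn2 (f x + dotv a x))) f0 dotv0r addr0.
  have := fb a; rewrite -/q; move: (\sum_x _) => W.
  case: (ger0P W) => _ <-; ring.
have pos : 0 < (2 ^ n)%:R :> int by rewrite ltr0n expn_gt0.
rewrite -(ler_pM2l pos) -!sum_pwalsh4.
under eq_bigr do rewrite gap bentX addr0.
under [leRHS]eq_bigr do rewrite gap.
(* The second moment is the same for every word, so the affine parts cancel and only the nonnegative
   products remain. *)
rewrite [leRHS]big_split /= !sumrB -!mulr_sumr !sum_pwalsh2 lerDl sumr_ge0 //.
move=> a _.
have [k hk] := pwalsh_odd u a (ltnW n2).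
exact: odd_sqr_bound hk ql.
Qed.

(* The Fourier transform diagonalises the form on the left, with eigenvalues
   [eigen u]. *)
Lemma eigen_form_ge n (u : word n) (g : word n -> int) :
  (forall v : word n, eigen u <= eigen v) ->
  eigen u * \sum_c g c ^+ 2 <=
  \sum_(t | delta2 t.1 + delta2 t.2 \in hamming n)
    \sum_c g c * g (c + (delta2 t.1 + delta2 t.2)).
Proof.
move=> umin; pose M : int := (2 ^ (2 ^ n - 1))%:R.
have pos : 0 < M by rewrite ltr0n expn_gt0.
rewrite -(ler_pM2l pos) [leRHS]mulr_sumr.
under [leRHS]eq_bigr do rewrite -sum_fourier_sqr.
rewrite exchange_big /=.
under [leRHS]eq_bigr do rewrite -mulr_sumr -/(eigen _).
have -> : M * (eigen u * \sum_c g c ^+ 2) = \sum_v fourier g v ^+ 2 * eigen u.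
  rewrite -mulr_suml mulrCA mulrC; congr (_ * _).
  have := sum_fourier_sqr g 0.
  under eq_bigr do rewrite dotv0r mulr1.
  by move=> ->; congr (_ * _); apply: eq_bigr => c _; rewrite addr0 expr2.
by apply: ler_sum => v _; rewrite ler_wpM2l ?sqr_ge0.
Qed.

(** * Ordered against unordered pairs *)

Lemma set2_eq (T : finType) (k l i j : T) : k != l ->
  (i != j) && ([set i; j] == [set k; l]) = ((i, j) \in [set (k, l); (l, k)]).
Proof.
move=> kl; rewrite !inE !xpair_eqE; apply/idP/idP.
  case/andP => ij /eqP/setP h.
  have := h j; have := h i; rewrite !inE !eqxx orbT.
  move=> /esym/orP[] /eqP ei /esym/orP[] /eqP ej; move: ij;
    by rewrite ei ej !eqxx ?orbT.
case/orP => /andP[/eqP -> /eqP ->]; first by rewrite kl eqxx.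
by rewrite eq_sym kl setUC eqxx.
Qed.

Lemma card_swap (T : finType) (k l : T) : k != l -> #|[set (k, l); (l, k)]| = 2%N.
Proof. by move=> kl; rewrite cards2 xpair_eqE (negbTE kl). Qed.

(** By symmetry of [e], exactly two ordered pairs lie over each counted set. *)
Lemma card_unordered_pairs (T : finType) (e : rel T) : symmetric e ->
  2 * #|[set A : {set T} | [exists x, exists y,
           [&& x != y, A == [set x; y] & e x y]]]|%:R
  = \sum_x \sum_y ((x != y) && e x y)%:R :> int.
Proof.
move=> eC; set S := [set A | _].
rewrite (pair_big xpredT xpredT (fun x y => ((x != y) && e x y)%:R)) /=.
transitivity (\sum_(p : T * T | (p.1 != p.2) && e p.1 p.2) 1 : int); last first.
  by rewrite big_mkcond; apply: eq_bigr => p _; case: ifP.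
rewrite (partition_big (fun p => [set p.1; p.2]) (mem S)) /=; last first.
  move=> [x y] /= /andP[xy exy]; rewrite inE; apply/existsP; exists x.
  by apply/existsP; exists y; rewrite xy exy eqxx.
rewrite mulr_natr -sumr_const; apply: eq_bigr => A.
rewrite inE => /existsP[k /existsP[l /and3P[kl /eqP -> ekl]]].
rewrite (eq_bigl (mem [set (k, l); (l, k)])) => [|[i j]] /=.
  by rewrite sumr_const card_swap.
rewrite andbAC set2_eq //; case: (boolP ((i, j) \in _)) => //=.
by rewrite !inE !xpair_eqE => /orP[] /andP[/eqP -> /eqP ->]; rewrite // eC.
Qed.

Lemma supp_delta2 m (p : 'I_m * 'I_m) : p.1 != p.2 ->
  [set i | delta2 p 0 i != 0] = [set p.1; p.2].
Proof.
move=> pp; apply/setP => i; rewrite !inE !mxE eqxx /=.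
case: (eqVneq i p.1) => [->|_]; first by rewrite (negbTE pp).
by case: (i == p.2).
Qed.

Lemma sum_delta2 m (G : 'rV['F_2]_m -> int) :
  \sum_(p | p.1 != p.2) G (delta2 p) = 2 * \sum_(z | wt z == 2%N) G z.
Proof.
rewrite (partition_big (@delta2 m) (fun z => wt z == 2%N)) => [|p pp] /=; last first.
  by rewrite /wt supp_delta2 // cards2 pp.
rewrite mulr_sumr; apply: eq_bigr => z /cards2P [k [l [kl hz]]].
transitivity (\sum_(p in [set (k, l); (l, k)]) G z); last first.
  by rewrite sumr_const card_swap // mulr_natl.
apply: eq_big => [[i j]|p /andP[_ /eqP ->]] //=.
rewrite -set2_eq //; case: (boolP (i != j)) => //= ij.
rewrite -hz -(@supp_delta2 _ (i, j)) //.
by apply/eqP/eqP => [->|/supp_inj].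
Qed.

(** * Distances between words with two parity bits *)

Lemma dH_sum m (x y : 'rV['F_2]_m) : dH x y = (\sum_i (x 0%R i != y 0%R i))%N.
Proof.
rewrite /dH -sum1_card big_mkcond; apply: eq_bigr => i _.
by rewrite inE; case: ifP.
Qed.

Lemma dH_row_mx m k (x y : 'rV['F_2]_m) (p q : 'rV['F_2]_k) :
  dH (row_mx x p) (row_mx y q) = (dH x y + dH p q)%N.
Proof.
rewrite !dH_sum big_split_ord /=.
by congr addn; apply: eq_bigr => i _; rewrite ?row_mxEl ?row_mxEr.
Qed.

Lemma dH_eq0 m (x y : 'rV['F_2]_m) : (dH x y == 0)%N = (x == y).
Proof. by rewrite dH_wt wt_eq0 addv_eq0. Qed.

Lemma dHC m (x y : 'rV['F_2]_m) : dH x y = dH y x.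
Proof. by rewrite !dH_wt addrC. Qed.

(** The distance is at most 2, and modulo 2 it is [par p + par q]. *)
Lemma dH2_eq1 (p q : 'rV['F_2]_2) : (dH p q == 1)%N = (par p != par q).
Proof.
have -> : (par p != par q) = odd (wt (p + q)).
  by rewrite odd_wt parD; case: (F2P (par p)) => ->; case: (F2P (par q)) => ->.
rewrite dH_wt.
have : (wt (p + q) <= 2)%N by rewrite -[X in (_ <= X)%N](card_ord 2) max_card.
by case: (wt _) => [|[|[|]]].
Qed.

Lemma par2 (p : 'rV['F_2]_2) : par p = p 0 0 + p 0 1.
Proof.
rewrite /par !big_ord_recl big_ord0 addr0; congr (_ + p 0 _); exact: val_inj.
Qed.

Lemma par_bcompl2 (p : 'rV['F_2]_2) : par (bcompl p) = par p.
Proof. by rewrite !par2 !mxE addrACA addF2 addr0. Qed.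

Lemma bcomplE m (p : 'rV['F_2]_m) : bcompl p = p + const_mx 1.
Proof. by apply/rowP => i; rewrite !mxE. Qed.

Lemma bcompl_inj m : injective (@bcompl m).
Proof. by move=> p q; rewrite !bcomplE => /addIr. Qed.

Lemma bcompl2_neq (p : 'rV['F_2]_2) : (bcompl p == p) = false.
Proof.
apply/eqP => /rowP /(_ 0); rewrite mxE => /eqP.
by rewrite -subr_eq0 addrAC subrr add0r.
Qed.

Lemma par_Pe p : p \in Pe -> par p = 0.
Proof. by rewrite !inE par2 => /orP[] /eqP ->; rewrite !mxE /= ?addF2 ?addr0. Qed.

Lemma par_Po p : p \in Po -> par p = 1.
Proof. by rewrite !inE par2 => /orP[] /eqP ->; rewrite !mxE /= ?addr0 ?add0r. Qed.

(** * Parity bits and the formula for [N2] *)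

Lemma nearest_hamming n (x : word n) : nearest x \in hamming n.
Proof. by rewrite /nearest; case: arg_minnP => //; rewrite mem_hamming syn0. Qed.

(** Treats both choices of [R] at once: [r] is 0 when even codewords receive parities from [Pe], and
    1 when from [Po]. *)
Definition proper_parity n (r : 'F_2) (a b : word n -> 'rV['F_2]_2) :=
  {in Ce n, forall c, par (a c) = r} /\ {in Co n, forall c, par (b c) = r + 1}.

(** Complementing two bits preserves their sum, so a non-codeword inherits that of its nearest
    codeword. *)
Lemma par_parity n r (a b : word n -> 'rV['F_2]_2) : proper_parity r a b ->
  forall x, par (parity a b x) = r + par (nearest x).
Proof.
case=> ha hb x.
have hc c : c \in hamming n -> par (codeparity a b c) = r + par c.
  move=> cH; rewrite /codeparity; case: ifP => cE.
    by rewrite ha //; move: cE; rewrite mem_Ce cH => /eqP ->; rewrite addr0.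
  move: cE; rewrite mem_Ce cH /= => /negbT cO.
  by rewrite hb ?mem_Co ?cH // (F2_neq0 cO).
rewrite /parity; case: ifP => xH; first by rewrite nearest_code // hc.
by rewrite par_bcompl2 hc // nearest_hamming.
Qed.

Lemma parity_add_delta n (a b : word n -> 'rV['F_2]_2) c s : c \in hamming n ->
  parity a b (c + delta_mx 0 s) = bcompl (parity a b c).
Proof.
move=> cH; rewrite /parity cH nearest_add_delta // hammingD //.
by rewrite mem_hamming syn_delta (negbTE (nzvec_neq0 s)).
Qed.

Lemma par_delta2 m (p : 'I_m * 'I_m) : par (delta2 p) = 0.
Proof. by rewrite parD !par_delta addF2. Qed.

Lemma syn_delta2 n (p : 'I_(2 ^ n - 1) * 'I_(2 ^ n - 1)) :
  (syn (delta2 p) == 0) = (p.1 == p.2).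
Proof. by rewrite synD !syn_delta addv_eq0 (inj_eq (@nzvec_inj n)). Qed.

(** Two distinct columns sum to a third, at [t]. Hence [c + delta2 p] is next to a codeword that
    differs from [c] by an odd-weight word, and its bits have the other sum. *)
Lemma parity_code_delta2 n r (a b : word n -> 'rV['F_2]_2) c p :
  proper_parity r a b -> c \in hamming n ->
  (parity a b c == parity a b (c + delta2 p)) = (p.1 == p.2).
Proof.
move=> hab cH; case: (eqVneq p.1 p.2) => [pp|pp].
  by rewrite /delta2 pp addv_self addr0 eqxx.
have := pp; rewrite -syn_delta2 => /syn_col [t /(_ t)]; rewrite eqxx => ht.
apply/negP => /eqP /(congr1 (@par 2)).
rewrite !(par_parity hab) nearest_code //.
rewrite -[c + delta2 p](addv_selfK (delta_mx 0 t)) nearest_add_delta; last first.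
  by rewrite -addrA hammingD.
move/addrI; rewrite !parD !par_delta addF2 addr0 => /eqP.
by rewrite eq_sym -subr_eq0 addrAC subrr add0r.
Qed.

(** If [t] is the flip that corrects the second word, both parities are complements of those at the
    codewords [c] and [c + (delta2 p + delta2 (s, t))], so equality carries over. The sum has at
    most one term. *)
Lemma parity_noncode_delta2 n r (a b : word n -> 'rV['F_2]_2) c s p :
  proper_parity r a b -> c \in hamming n ->
  ((parity a b (c + delta_mx 0 s) == parity a b (c + delta_mx 0 s + delta2 p))%:R)%R
  = \sum_(t | delta2 p + delta2 (s, t) \in hamming n)
     (parity a b c == parity a b (c + (delta2 p + delta2 (s, t))))%:R :> int.
Proof.
move=> hab cH; rewrite parity_add_delta //.
have split t : delta2 p + delta2 (s, t) = delta_mx 0 s + delta2 p + delta_mx 0 t.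
  by rewrite [in LHS]/delta2 /= addrA [_ + delta_mx 0 s]addrC.
case: (eqVneq (syn (delta_mx 0 s + delta2 p)) 0) => [h|/syn_col [t ht]].
  (* Here the second word is itself a codeword: no [t] qualifies, and as it differs from [c] in odd
     weight, the bit sums disagree. *)
  rewrite big1 => [|t]; last first.
    rewrite split hammingD ?mem_hamming ?h // syn_delta.
    by rewrite (negbTE (nzvec_neq0 t)).
  case: eqP => // /(congr1 (@par 2)).
  rewrite par_bcompl2 !(par_parity hab) -addrA !nearest_code //; last first.
    by rewrite hammingD // mem_hamming h.
  move/addrI; rewrite !parD !par_delta addF2 addr0 => /eqP.
  by rewrite eq_sym -subr_eq0 addrAC subrr add0r.
rewrite (eq_bigl (pred1 t)) => [|t']; last by rewrite split ht.
rewrite big_pred1_eq split.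
have tH : c + (delta_mx 0 s + delta2 p + delta_mx 0 t) \in hamming n.
  by rewrite hammingD // ht.
have := parity_add_delta a b t tH; rewrite !addrA addv_selfK => ->.
by rewrite (inj_eq (@bcompl_inj 2)).
Qed.

(** For proper assignments, these are the ordered pairs at distance 1 whose parities differ in one
    bit; phrasing this through [nearest] shows independence from the assignments. *)
Definition light_pairs n : int := \sum_(x : word n) \sum_(y : word n)
  ((dH x y == 1%N) && (par (nearest x) != par (nearest y)))%:R.

(** The distance splits as 1 + 1 or 2 + 0; the split 0 + 2 is excluded by [x != y]. *)
Lemma Enc_dH2 n r (a b : word n -> 'rV['F_2]_2) x y : proper_parity r a b ->
  ((x != y) && (dH (Enc a b x) (Enc a b y) == 2%N))%:R =
  ((dH x y == 1%N) && (par (nearest x) != par (nearest y)))%:R +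
  ((dH x y == 2%N) && (parity a b x == parity a b y))%:R :> int.
Proof.
move=> hab; rewrite /Enc dH_row_mx -dH_eq0 -(dH_eq0 (parity a b x)).
have -> : (par (nearest x) != par (nearest y)) =
          (dH (parity a b x) (parity a b y) == 1%N).
  by rewrite dH2_eq1 !(par_parity hab) (inj_eq (addrI r)).
by case: (dH x y) => [|[|[|k]]]; case: (dH _ _) => [|[|j]].
Qed.

(** One factor 2 orders the pairs of words, the other orders the two coordinates where they differ.
    Only the last sum depends on the assignments. *)
Lemma N2_formula n r (a b : word n -> 'rV['F_2]_2) : proper_parity r a b ->
  4 * (N2 a b)%:R =
  2 * light_pairs n
  + \sum_(c in hamming n)
      \sum_(p : 'I_(2 ^ n - 1) * 'I_(2 ^ n - 1)) (p.1 == p.2)%:R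
  - \sum_(c : word n) \sum_(p : 'I_(2 ^ n - 1) * 'I_(2 ^ n - 1)) (p.1 == p.2)%:R
  + \sum_(c in hamming n) \sum_(t | delta2 t.1 + delta2 t.2 \in hamming n)
      (parity a b c == parity a b (c + (delta2 t.1 + delta2 t.2)))%:R :> int.
Proof.
move=> hab.
have -> : 4 * (N2 a b)%:R = 2 * (2 * (N2 a b)%:R) :> int by ring.
rewrite (card_unordered_pairs
  (e := fun x y => dH (Enc a b x) (Enc a b y) == 2%N));
  last by move=> x y; rewrite dHC.
under eq_bigr do under eq_bigr do rewrite (Enc_dH2 _ _ hab).
under eq_bigr do rewrite big_split /=.
rewrite big_split mulrDr /= -!addrA; congr (_ + _).
pose diag : int := \sum_(p : 'I_(2 ^ n - 1) * 'I_(2 ^ n - 1)) (p.1 == p.2)%:R.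
have step x : 2 * \sum_y ((dH x y == 2%N) && (parity a b x == parity a b y))%:R
    = \sum_p (parity a b x == parity a b (x + delta2 p))%:R - diag :> int.
  rewrite (bigID (fun p => p.1 == p.2)) /=.
  rewrite (sum_delta2 (fun z => (parity a b x == parity a b (x + z))%:R)).
  have -> : \sum_(p | p.1 == p.2)
      (parity a b x == parity a b (x + delta2 p))%:R = diag.
    rewrite [LHS]big_mkcond; apply: eq_bigr => p _; case: eqP => // pp.
    by rewrite /delta2 pp addv_self addr0 eqxx.
  rewrite addrAC subrr add0r (sum_translate x); congr (2 * _).
  rewrite [RHS]big_mkcond; apply: eq_bigr => y _.
  by rewrite dH_wt addrCA addv_self addr0 [y + x]addrC; case: ifP.
rewrite mulr_sumr (eq_bigr _ (fun x _ => step x)).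
rewrite sumrB addrCA [RHS]addrC; congr (_ - _).
(* Codewords match only for equal coordinates; non-codewords are moved to their nearest codewords
   and yield the sum over quadruples. *)
rewrite (bigID (mem (hamming n))) /=; congr (_ + _).
  apply: eq_bigr => c cH; apply: eq_bigr => p _.
  by rewrite (parity_code_delta2 _ hab).
rewrite sum_noncode; apply: eq_bigr => c cH.
rewrite (eq_bigr _ (fun s _ => eq_bigr _ (fun p _ =>
  parity_noncode_delta2 s p hab cH))).
rewrite exchange_big /= (eq_bigr (fun p => \sum_s \sum_t
  if delta2 p + delta2 (s, t) \in hamming n then
    (parity a b c == parity a b (c + (delta2 p + delta2 (s, t))))%:R else 0))
  => [|p _]; last first.
  by apply: eq_bigr => s _; rewrite big_mkcond.
rewrite [RHS]big_mkcond /= -(pair_big xpredT xpredT (fun p q =>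
  if delta2 p + delta2 q \in hamming n then
    (parity a b c == parity a b (c + (delta2 p + delta2 q)))%:R else 0)) /=.
apply: eq_bigr => p _.
rewrite -(pair_big xpredT xpredT (fun s t =>
  if delta2 p + delta2 (s, t) \in hamming n then
    (parity a b c == parity a b (c + (delta2 p + delta2 (s, t))))%:R else 0)) /=.
by [].
Qed.

(** * The cut on the odd codewords *)

Definition cut n (p : 'rV['F_2]_2) (b : word n -> 'rV['F_2]_2)
    (c : word n) : int :=
  if c \in Co n then (if b c == p then 1 else -1) else 0.

Lemma parity_Ce n (a b : word n -> 'rV['F_2]_2) c :
  c \in Ce n -> parity a b c = a c.
Proof.
by move=> cE; have := cE; rewrite mem_Ce => /andP[cH _];
  rewrite /parity /codeparity cH cE.
Qed.

Lemma parity_Co n (a b : word n -> 'rV['F_2]_2) c :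
  c \in Co n -> parity a b c = b c.
Proof.
rewrite mem_Co => /andP[cH cO].
by rewrite /parity /codeparity cH mem_Ce cH (negbTE cO).
Qed.

Lemma Ce_add n (c z : word n) : z \in Ce n -> (c + z \in Ce n) = (c \in Ce n).
Proof.
rewrite !mem_Ce => /andP[zH /eqP z0].
by rewrite addrC hammingD // parD z0 add0r.
Qed.

Lemma Co_add n (c z : word n) : z \in Ce n -> (c + z \in Co n) = (c \in Co n).
Proof.
rewrite mem_Ce !mem_Co => /andP[zH /eqP z0].
by rewrite addrC hammingD // parD z0 add0r.
Qed.

Lemma delta2D_Ce n p q :
  delta2 p + delta2 q \in hamming n -> delta2 p + delta2 q \in Ce n.
Proof. by rewrite mem_Ce => ->; rewrite parD !par_delta2 addr0 eqxx. Qed.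

Lemma cutP n (p : 'rV['F_2]_2) (b : word n -> 'rV['F_2]_2) c c' :
  assignment (Co n) [set p; bcompl p] b -> c \in Co n -> c' \in Co n ->
  2 * (b c == b c')%:R = 1 + cut p b c * cut p b c'.
Proof.
move=> hb cO c'O; rewrite /cut cO c'O.
have := hb _ cO; have := hb _ c'O; rewrite !inE.
by move=> /orP[] /eqP -> /orP[] /eqP ->;
  rewrite ?eqxx ?[p == bcompl p]eq_sym ?bcompl2_neq ?eqxx.
Qed.

Lemma sum_cut_sqr n p (b : word n -> 'rV['F_2]_2) :
  \sum_c cut p b c ^+ 2 = #|Co n|%:R.
Proof.
rewrite -sum1_card natr_sum [RHS]big_mkcond; apply: eq_bigr => c _.
by rewrite /cut; case: ifP => // _; case: ifP.
Qed.

(** The translations have even weight, hence preserve [Ce n] and [Co n]. The even part involves [a]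
    alone; on [Co n] twice the indicator of equal colours is 1 plus a product of signs. As [cut] is
    0 off [Co n], the form extends to all words, as [eigen_form_ge] requires. *)
Lemma monochromatic_sum n r p (a b : word n -> 'rV['F_2]_2) :
  proper_parity r a b -> assignment (Co n) [set p; bcompl p] b ->
  2 * \sum_(c in hamming n) \sum_(t | delta2 t.1 + delta2 t.2 \in hamming n)
      (parity a b c == parity a b (c + (delta2 t.1 + delta2 t.2)))%:R
  = 2 * \sum_(t | delta2 t.1 + delta2 t.2 \in hamming n)
          \sum_(c in Ce n) (a c == a (c + (delta2 t.1 + delta2 t.2)))%:R
  + \sum_(t | delta2 t.1 + delta2 t.2 \in hamming n) #|Co n|%:R
  + \sum_(t | delta2 t.1 + delta2 t.2 \in hamming n)
      \sum_c cut p b c * cut p b (c + (delta2 t.1 + delta2 t.2)) :> int.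
Proof.
move=> hab hb; rewrite exchange_big /= !mulr_sumr -!big_split /=.
apply: eq_bigr => t /delta2D_Ce; move: (_ + _) => z zE.
rewrite (bigID (fun c => par c == 0)) /= mulrDr -addrA; congr (2 * _ + _).
  apply: eq_big => c; first by rewrite mem_Ce.
  by rewrite -mem_Ce => cE; rewrite !parity_Ce // Ce_add.
rewrite -sum1_card natr_sum [X in 2 * X](eq_bigl (mem (Co n))) => [|c]; last first.
  by rewrite -mem_Co.
rewrite mulr_sumr [X in _ + X](bigID (mem (Co n))) /= addrA.
rewrite -big_split /= [X in _ + X]big1 ?addr0 => [|c cO]; last first.
  by rewrite /cut (negbTE cO) mul0r.
apply: eq_bigr => c cO; rewrite !parity_Co ?Co_add //.
by rewrite (cutP hb) ?Co_add.
Qed.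

(** * Optimality of the bent cut *)

Lemma proper_parityP n R R' (a b : word n -> 'rV['F_2]_2) :
  [set R; R'] = [set Pe; Po] -> assignment (Ce n) R a -> assignment (Co n) R' b ->
  exists r, proper_parity r a b.
Proof.
move=> hRR' ha hb.
have PeNo : Pe != Po.
  apply/eqP => h; have : bits2 0 0 \in Pe by rewrite !inE eqxx.
  by move=> e; have := par_Pe e; rewrite h in e; rewrite (par_Po e).
have RNR' : R != R'.
  apply/eqP => RR'; have := congr1 (fun A : {set _} => #|A|) hRR'.
  by rewrite RR' !cards2 eqxx PeNo.
have : (R, R') \in [set (Pe, Po); (Po, Pe)].
  by rewrite -set2_eq // RNR' hRR' eqxx.
rewrite !inE !xpair_eqE => /orP[] /andP[/eqP eR /eqP eR']; subst R R'.
  exists 0; split=> c cC; first by rewrite par_Pe ?ha.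
  by rewrite par_Po ?hb // add0r.
exists 1; split=> c cC; first by rewrite par_Po ?ha.
by rewrite par_Pe ?hb // addF2.
Qed.

(** Row [i] of [permP] has its only 1 at the index of [tnth w i + w'], an even codeword as the sum
    of two odd ones. *)
Lemma cutvecE n (v : #|Ce n|.-tuple (word n)) (w : #|Co n|.-tuple (word n))
    (w' u : word n) i : uniq v -> v =i Ce n -> w =i Co n -> w' \in Co n ->
  cutvec v w w' u i 0 = sgn2 (dotv u (tnth w i + w')).
Proof.
move=> v_uniq hv hw hw'; have wO : tnth w i \in Co n by rewrite -hw mem_tnth.
have : tnth w i + w' \in v.
  move: wO hw'; rewrite hv mem_Ce !mem_Co.
  move=> /andP[h1 /F2_neq0 h2] /andP[h3 /F2_neq0 h4].
  by rewrite hammingD // h3 parD h2 h4 addF2 eqxx.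
move=> /tnthP [k hk]; rewrite mxE (bigD1 k) //= !mxE -hk addv_selfK eqxx mul1r.
rewrite big1 ?addr0 // => j jk; rewrite !mxE.
case: eqP => [e|]; last by rewrite mul0r.
case/eqP: jk; apply/(tuple_uniqP v v_uniq).
by rewrite -hk e addv_selfK.
Qed.

Theorem theorem8 (n : nat) (hn : (2 <= n)%N) (hn_even : ~~ odd n)
    (v : #|Ce n|.-tuple (word n)) (hv_uniq : uniq v) (hv : v =i Ce n)
    (w : #|Co n|.-tuple (word n)) (hw_uniq : uniq w) (hw : w =i Co n)
    (w' : word n) (hw' : w' \in Co n)
    (f : 'rV['F_2]_n -> 'F_2) (hf : bent f) (hf0 : f 0 = 0)
    (R R' : {set 'rV['F_2]_2}) (hRR' : [set R; R'] = [set Pe; Po])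
    (p' : 'rV['F_2]_2) (hp' : R' = [set p'; bcompl p'])
    (b : word n -> 'rV['F_2]_2)
    (hb_pos : forall i, cutvec v w w' (punctured f) i 0 = 1 ->
                b (tnth w i) = p')
    (hb_neg : forall i, cutvec v w w' (punctured f) i 0 = -1 ->
                b (tnth w i) = bcompl p') :
  optimal R R' b.
Proof.
set u := punctured f in hb_pos hb_neg.
have cut_b c : c \in Co n -> b c \in R' /\ cut p' b c = sgn2 (dotv u (c + w')).
  move=> cO; have := cO; rewrite -hw => /tnthP [i ci].
  have := hb_neg i; have := hb_pos i; rewrite cutvecE // -ci /cut cO hp' !inE.
  case: (sgn2P (dotv u (c + w'))) => -> h1 h2; first by rewrite h1 // eqxx.
  by rewrite h2 // bcompl2_neq eqxx.
have hb : assignment (Co n) R' b by move=> c /cut_b [].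
split=> // a b' ha hb'.
have [r hab] := proper_parityP hRR' ha hb.
have [r' hab'] := proper_parityP hRR' ha hb'.
rewrite -(ler_nat int) -(ler_pM2l (_ : 0 < 4)) //.
rewrite (N2_formula hab) (N2_formula hab').
rewrite lerD2l -(ler_pM2l (_ : 0 < 2)) //.
rewrite hp' in hb hb'.
(* Both counts use the same [a], so the even parts cancel and two quadratic forms remain to be
   compared. *)
rewrite (monochromatic_sum hab hb) (monochromatic_sum hab' hb') lerD2l.
have umin (y : word n) : eigen u <= eigen y by apply: eigen_bent_min.
(* The form of [b'] obeys the eigenvalue bound, so it suffices that the form of [b] is at most
   [eigen u] times the size of [Co n]. *)
apply: le_trans (eigen_form_ge (cut p' b') umin).
rewrite sum_cut_sqr mulr_suml; apply: ler_sum => t /delta2D_Ce.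
move: (_ + _) => z zE.
rewrite (bigID (mem (Co n))) /= [X in _ + X]big1 ?addr0 => [|c cO]; last first.
  by rewrite /cut (negbTE cO) mul0r.
rewrite mulr_natr -sumr_const; apply: ler_sum => c cO.
have [_ ->] := cut_b _ cO; have [_ ->] := cut_b _ (etrans (Co_add c zE) cO).
(* The signs at [c] and [c + z] multiply to [sgn2 (dotv u z)], whatever [c] and [w'] are. *)
by rewrite addrAC [dotv _ (_ + z)]dotvDr sgn2D mulrA sgn2_sqr mul1r.
Qed.
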